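(* Let $A$ be a division ring, let $\sigma\in\operatorname{Aut}(A)$, and let $D=A((x;\sigma))$ be the division ring of twisted Laurent series, with multiplication determined by $xa=\sigma(a)x$ for $a\in A$. Suppose that either $A^*$ is nonabelian or $\sigma\ne\operatorname{id}_A$. Then $D^*$ contains no abelian maximal subgroup.
   Context: For a division ring $R$, $R^*=R\setminus\{0\}$ is its multiplicative group. Elements of $A((x;\sigma))$ are formal series $\sum_{i\ge k}a_ix^i$ with $k\in\mathbb Z$ and $a_i\in A$, added coefficientwise and multiplied using $x^ia=\sigma^i(a)x^i$. A maximal subgroup of a group $G$ is a proper subgroup not properly contained in any proper subgroup of $G$. *)

(* Defs.v *)
From HB Require Import structures.
From mathcomp Require Import all_boot all_order all_algebra.
From mathcomp Require Import boolp classical_sets functions cardinality fsbigop.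
From mathcomp Require Import zify.

Set Implicit Arguments.
Unset Strict Implicit.
Unset Printing Implicit Defensive.

Import Order.TTheory GRing.Theory Num.Theory.
Local Open Scope ring_scope.

HB.mixin Record isDivisionRing R of GRing.UnitRing R := {
  divring_unitP : GRing.field_axiom R
}.

#[short(type="divRingType")]
HB.structure Definition DivisionRing :=
  {R of isDivisionRing R & GRing.UnitRing R}.

Section MulGroup.
Variable R : divRingType.

Record mulgroup := MulGroup {mulgroup_val : R; _ : mulgroup_val != 0}.

HB.instance Definition _ := [isSub for mulgroup_val].
HB.instance Definition _ := [Choice of mulgroup by <:].

Implicit Types u v w : mulgroup.

Lemma mulgroup_unit u : val u \is a GRing.unit.
Proof. by apply: divring_unitP; case: u. Qed.

Lemma unit_neq0 (x : R) : x \is a GRing.unit -> x != 0.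
Proof. by apply: contraTneq => ->; rewrite unitr0. Qed.

Definition mulgroup_one : mulgroup := MulGroup (oner_neq0 R).

Lemma mulgroup_mul_subproof u v : val u * val v != 0.
Proof. by apply: unit_neq0; rewrite unitrMl ?mulgroup_unit. Qed.
Definition mulgroup_mul u v := MulGroup (mulgroup_mul_subproof u v).

Lemma mulgroup_inv_subproof u : (val u)^-1 != 0.
Proof. by apply: unit_neq0; rewrite unitrV mulgroup_unit. Qed.
Definition mulgroup_inv u := MulGroup (mulgroup_inv_subproof u).

Lemma mulgroup_mulA : associative mulgroup_mul.
Proof. by move=> u v w; apply: val_inj; rewrite /= mulrA. Qed.
Lemma mulgroup_mul1g : left_id mulgroup_one mulgroup_mul.
Proof. by move=> u; apply: val_inj; rewrite /= mul1r. Qed.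
Lemma mulgroup_mulg1 : right_id mulgroup_one mulgroup_mul.
Proof. by move=> u; apply: val_inj; rewrite /= mulr1. Qed.
Lemma mulgroup_mulVg : left_inverse mulgroup_one mulgroup_inv mulgroup_mul.
Proof. by move=> u; apply: val_inj; rewrite /= mulVr ?mulgroup_unit. Qed.
Lemma mulgroup_mulgV : right_inverse mulgroup_one mulgroup_inv mulgroup_mul.
Proof. by move=> u; apply: val_inj; rewrite /= mulrV ?mulgroup_unit. Qed.

HB.instance Definition _ := isGroup.Build mulgroup
  mulgroup_mulA mulgroup_mul1g mulgroup_mulg1 mulgroup_mulVg mulgroup_mulgV.

End MulGroup.

Section Subgroups.
Local Open Scope classical_set_scope.
Variable G : groupType.

Definition subgroup (M : set G) := group_closed (mem M).

Definition abelian_set (M : set G) :=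
  forall x y : G, M x -> M y -> commute x y.

Definition maximal_subgroup (M : set G) :=
  [/\ subgroup M, M `<` [set: G] &
      forall H : set G, subgroup H -> H `<` [set: G] -> ~ M `<` H].

End Subgroups.

(* The inverse is unique, so carrying it as data adds no information; it makes
   negative powers of the automorphism available without choice. *)
Record ringAut (A : nzRingType) := RingAut {
  aut_fun :> {rmorphism A -> A};
  aut_inv : A -> A;
  autK : cancel aut_fun aut_inv;
  autKV : cancel aut_inv aut_fun
}.

Section AutPower.
Variables (A : nzRingType) (sigma : ringAut A).

Definition autX (i : int) : A -> A :=
  match i with
  | Posz n => iter n sigma
  | Negz n => iter n.+1 (aut_inv sigma)
  end.

Lemma autXS i a : autX (i + 1) a = sigma (autX i a).
Proof.
case: i => [n|[|n]]; first by rewrite -PoszD addn1.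
  by rewrite /= autKV.
have -> : Negz n.+1 + 1 = Negz n by rewrite !NegzE; lia.
by rewrite /= autKV.
Qed.

Lemma autXN1 i a : autX (i - 1) a = aut_inv sigma (autX i a).
Proof. by rewrite -{2}[i](subrK 1) autXS autK. Qed.

Lemma autXD i j a : autX (i + j) a = autX i (autX j a).
Proof.
elim/int_ind: i => [|n IH|n IH]; first by rewrite add0r.
  have -> : n.+1%:Z = n%:Z + 1 by lia.
  by rewrite addrAC !autXS IH.
have -> : - n.+1%:Z = - n%:Z - 1 by lia.
by rewrite addrAC !autXN1 IH.
Qed.

Lemma autX_zmod_morphism i : zmod_morphism (autX i).
Proof.
elim/int_ind: i => [|n IH|n IH] a b //.
  have -> : n.+1%:Z = n%:Z + 1 by lia.
  by rewrite !autXS IH rmorphB.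
have -> : - n.+1%:Z = - n%:Z - 1 by lia.
by rewrite !autXN1 IH; apply: (can_inj (@autK _ sigma)); rewrite rmorphB !autKV.
Qed.

Lemma autX_monoid_morphism i : monoid_morphism (autX i).
Proof.
elim/int_ind: i => [|n IH|n IH]; first by split.
  have -> : n.+1%:Z = n%:Z + 1 by lia.
  by split=> [|a b]; rewrite !autXS IH ?rmorph1 ?rmorphM.
have -> : - n.+1%:Z = - n%:Z - 1 by lia.
split=> [|a b]; rewrite !autXN1 IH;
  by apply: (can_inj (@autK _ sigma)); rewrite ?rmorphM !autKV ?rmorph1.
Qed.

HB.instance Definition _ i :=
  GRing.isZmodMorphism.Build A A (autX i) (autX_zmod_morphism i).
HB.instance Definition _ i :=
  GRing.isMonoidMorphism.Build A A (autX i) (autX_monoid_morphism i).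

End AutPower.

Section BoundedBelow.
Variable A : nzRingType.
Implicit Types f g : int -> A.

Definition bounded_below : {pred int -> A} :=
  [pred f | `[< exists k : int, forall i, i < k -> f i = 0 >]].

Lemma bounded_belowP f :
  reflect (exists k : int, forall i, i < k -> f i = 0) (f \in bounded_below).
Proof. exact: asboolP. Qed.

Lemma bounded_below_zmod_closed : zmod_closed bounded_below.
Proof.
split; first by apply/bounded_belowP; exists 0.
move=> f g /bounded_belowP[a fa] /bounded_belowP[b gb].
apply/bounded_belowP; exists (Num.min a b) => i.
by rewrite lt_min => /andP[ia ib]; rewrite !fctE fa ?gb ?subr0.
Qed.
HB.instance Definition _ :=
  GRing.isZmodClosed.Build (int -> A) bounded_below bounded_below_zmod_closed.

End BoundedBelow.

Arguments bounded_below A : clear implicits.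

(* laurent sigma is A((x; sigma)), the series f standing for the formal sum of
   the f i x^i. The parameter sigma does not occur in the fields: it determines
   the multiplication below. *)
Record laurent (A : nzRingType) (sigma : ringAut A) := Laurent {
  lcoef :> int -> A;
  laurentP : lcoef \in bounded_below A
}.

Section Laurent.
Variables (A : nzRingType) (sigma : ringAut A).
Implicit Types f g : int -> A.
Local Notation laurent := (laurent sigma).
Local Notation bounded_below := (bounded_below A).
Local Notation Laurent := (@Laurent A sigma).

HB.instance Definition _ := [isSub for @lcoef A sigma].
HB.instance Definition _ := [Choice of laurent by <:].
HB.instance Definition _ := [SubChoice_isSubZmodule of laurent by <:].

Implicit Types u v w : laurent.

Lemma laurent_ext u v : (forall i, u i = v i) -> u = v.
Proof. by move=> uv; apply: val_inj; apply: funext. Qed.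

Lemma laurent_bound u : exists k : int, forall i, i < k -> u i = 0.
Proof. exact/bounded_belowP/laurentP. Qed.

Lemma lcoefD u v i : (u + v) i = u i + v i.
Proof. by []. Qed.

Lemma lcoef0 i : (0 : laurent) i = 0.
Proof. by []. Qed.

(* (a x^i) (b x^(n - i)) = a sigma^i(b) x^n; only finitely many terms of the
   sum are nonzero when f and g are bounded below. *)
Definition lmul_fun f g (n : int) : A :=
  \sum_(i \in [set: int]) f i * autX sigma i (g (n - i)).

Definition zrange (a : int) (m : nat) : seq int :=
  [seq a + k%:Z | k <- iota 0 m].

Lemma zrange_uniq a m : uniq (zrange a m).
Proof. by rewrite map_inj_uniq ?iota_uniq // => i j; lia. Qed.

Lemma mem_zrange a m i : (i \in zrange a m) = (a <= i < a + m%:Z).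
Proof.
apply/mapP/idP => [[k]|H]; first by rewrite mem_iota => km ->; lia.
by exists (absz (i - a)); rewrite ?mem_iota; lia.
Qed.

Lemma lmul_funE f g (a b n : int) (s : seq int) :
  (forall i, i < a -> f i = 0) -> (forall i, i < b -> g i = 0) ->
  uniq s -> (forall i, a <= i <= n - b -> i \in s) ->
  lmul_fun f g n = \sum_(i <- s) f i * autX sigma i (g (n - i)).
Proof.
move=> fa gb us sP; rewrite /lmul_fun (fsbigE s) //.
  by apply: eq_bigl => i; rewrite in_setT.
move=> i _ /negP si.
have [ia|ai] := ltP i a; first by rewrite fa ?mul0r.
have [ib|bi] := ltP (n - i) b; first by rewrite gb ?rmorph0 ?mulr0.
by case: si; apply: sP; lia.
Qed.

Lemma lmul_subproof u v : lmul_fun u v \in bounded_below.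
Proof.
have [[a ua] [b vb]] := (laurent_bound u, laurent_bound v).
apply/bounded_belowP; exists (a + b) => n nab.
by rewrite (lmul_funE (s := [::]) ua vb) ?big_nil // => i; lia.
Qed.
Definition lmul u v := Laurent (lmul_subproof u v).

Lemma lmono_subproof (a : A) (k : int) :
  (fun i : int => if i == k then a else 0) \in bounded_below.
Proof. by apply/bounded_belowP; exists k => i ik; rewrite ifF //; lia. Qed.

Definition lmono a k : laurent := Laurent (lmono_subproof a k).

Lemma lcoef_mono a k i : lmono a k i = if i == k then a else 0.
Proof. by []. Qed.

Lemma lcoef_mulE u v (a b n : int) (s : seq int) :
  (forall i, i < a -> u i = 0) -> (forall i, i < b -> v i = 0) ->
  uniq s -> (forall i, a <= i <= n - b -> i \in s) ->
  lmul u v n = \sum_(i <- s) u i * autX sigma i (v (n - i)).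
Proof. exact: lmul_funE. Qed.

Lemma lcoef_monol a k u n : lmul (lmono a k) u n = a * autX sigma k (u (n - k)).
Proof.
have [b ub] := laurent_bound u.
have mk i : i < k -> lmono a k i = 0 by rewrite lcoef_mono => ik; rewrite ifF //; lia.
rewrite (lcoef_mulE (s := k :: rem k (zrange k (absz (n - b - k + 1)))) mk ub).
- rewrite big_cons lcoef_mono eqxx big_seq big1 ?addr0 // => i.
  rewrite mem_rem_uniq ?zrange_uniq // inE => /andP[/negPf ik _].
  by rewrite lcoef_mono ik mul0r.
- by rewrite /= mem_rem_uniqF ?rem_uniq ?zrange_uniq.
- move=> i ib; rewrite inE mem_rem_uniq ?zrange_uniq // inE.
  by case: eqP => //= ik; rewrite mem_zrange; lia.
Qed.

Lemma lcoef_monor b k u n :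
  lmul u (lmono b k) n = u (n - k) * autX sigma (n - k) b.
Proof.
have [a ua] := laurent_bound u.
have mk i : i < k -> lmono b k i = 0 by rewrite lcoef_mono => ik; rewrite ifF //; lia.
rewrite (lcoef_mulE (s := n - k :: rem (n - k) (zrange a (absz (n - k - a + 1)))) ua mk).
- rewrite big_cons lcoef_mono ifT; last by lia.
  rewrite big_seq big1 ?addr0 // => i.
  rewrite mem_rem_uniq ?zrange_uniq // inE => /andP[ik _].
  by rewrite lcoef_mono ifF ?rmorph0 ?mulr0 //; lia.
- by rewrite /= mem_rem_uniqF ?rem_uniq ?zrange_uniq.
- move=> i ib; rewrite inE mem_rem_uniq ?zrange_uniq // inE.
  by case: eqP => //= ik; rewrite mem_zrange; lia.
Qed.

Lemma lmonoM a i b j :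
  lmul (lmono a i) (lmono b j) = lmono (a * autX sigma i b) (i + j).
Proof.
apply: laurent_ext => n; rewrite lcoef_monol !lcoef_mono.
have -> : (n - i == j) = (n == i + j) by lia.
by case: eqP => // _; rewrite rmorph0 mulr0.
Qed.

Lemma lmulA : associative lmul.
Proof.
move=> u v w; apply: laurent_ext => n.
have [[a ua] [b vb] [c wc]] :=
  And3 (laurent_bound u) (laurent_bound v) (laurent_bound w).
have uv i : i < a + b -> lmul u v i = 0.
  by move=> iab; rewrite (lcoef_mulE (s := [::]) ua vb) ?big_nil // => j; lia.
have vw i : i < b + c -> lmul v w i = 0.
  by move=> ibc; rewrite (lcoef_mulE (s := [::]) vb wc) ?big_nil // => j; lia.
pose N := (absz a + absz b + absz c + absz n + 1)%N.
pose W := zrange (- (3 * N)%N%:Z) (6 * N)%N.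
have uW : uniq W by exact: zrange_uniq.
rewrite (lcoef_mulE (s := W) ua vw) //; last by move=> i; rewrite mem_zrange; lia.
rewrite (lcoef_mulE (s := W) uv wc) //; last by move=> i; rewrite mem_zrange; lia.
have E1 i : u i * autX sigma i (lmul v w (n - i)) =
    \sum_(k <- W) u i * autX sigma i (v (k - i)) * autX sigma k (w (n - k)).
  have [ia|ai] := ltP i a.
    by rewrite ua // mul0r big1 // => k _; rewrite !mul0r.
  have [ib|bi] := ltP (n - i) (b + c).
    rewrite vw // rmorph0 mulr0 big1 // => k _.
    have [kb|bk] := ltP (k - i) b; first by rewrite vb // rmorph0 mulr0 mul0r.
    by rewrite (wc (n - k)) ?rmorph0 ?mulr0 //; lia.
  rewrite (lcoef_mulE (s := [seq k - i | k <- W]) vb wc).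
  - rewrite big_map rmorph_sum mulr_sumr; apply: eq_bigr => k _.
    rewrite rmorphM mulrA /= -autXD; congr (_ * autX _ _ (w _)); lia.
  - by rewrite map_inj_uniq // => x y; lia.
  - move=> j jP; apply/mapP; exists (i + j); last by lia.
    by rewrite mem_zrange; lia.
rewrite (eq_bigr _ (fun i _ => E1 i)) exchange_big big_seq [RHS]big_seq.
apply: eq_bigr => k; rewrite mem_zrange => kW.
have [kc|ck] := ltP (n - k) c.
  by rewrite (wc (n - k)) // rmorph0 mulr0 big1 // => i _; rewrite mulr0.
rewrite (lcoef_mulE (s := W) ua vb) // ?mulr_suml //.
by move=> i; rewrite mem_zrange; lia.
Qed.

Definition lone := lmono 1 0.

Lemma lmul1l : left_id lone lmul.
Proof.
by move=> u; apply: laurent_ext => n; rewrite lcoef_monol mul1r subr0.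
Qed.

Lemma lmul1r : right_id lone lmul.
Proof.
by move=> u; apply: laurent_ext => n; rewrite lcoef_monor rmorph1 mulr1 subr0.
Qed.

Lemma lmulDl : left_distributive lmul +%R.
Proof.
move=> u v w; apply: laurent_ext => n.
have [[a ua] [b vb] [c wc]] :=
  And3 (laurent_bound u) (laurent_bound v) (laurent_bound w).
pose d := Num.min a b.
have u' i : i < d -> u i = 0 by rewrite lt_min => /andP[/ua].
have v' i : i < d -> v i = 0 by rewrite lt_min => /andP[_ /vb].
have uv i : i < d -> (u + v) i = 0 by move=> id; rewrite lcoefD u' ?v' ?addr0.
pose s := zrange d (absz (n - c - d + 1)).
have sP i : d <= i <= n - c -> i \in s by rewrite mem_zrange; lia.
have us : uniq s by exact: zrange_uniq.
rewrite lcoefD (lcoef_mulE uv wc us sP) (lcoef_mulE u' wc us sP).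
rewrite (lcoef_mulE v' wc us sP) -big_split; apply: eq_bigr => i _.
by rewrite lcoefD mulrDl.
Qed.

Lemma lmulDr : right_distributive lmul +%R.
Proof.
move=> w u v; apply: laurent_ext => n.
have [[a ua] [b vb] [c wc]] :=
  And3 (laurent_bound u) (laurent_bound v) (laurent_bound w).
pose d := Num.min a b.
have u' i : i < d -> u i = 0 by rewrite lt_min => /andP[/ua].
have v' i : i < d -> v i = 0 by rewrite lt_min => /andP[_ /vb].
have uv i : i < d -> (u + v) i = 0 by move=> id; rewrite lcoefD u' ?v' ?addr0.
pose s := zrange c (absz (n - d - c + 1)).
have sP i : c <= i <= n - d -> i \in s by rewrite mem_zrange; lia.
have us : uniq s by exact: zrange_uniq.
rewrite lcoefD (lcoef_mulE wc uv us sP) (lcoef_mulE wc u' us sP).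
rewrite (lcoef_mulE wc v' us sP) -big_split; apply: eq_bigr => i _.
by rewrite lcoefD rmorphD mulrDr.
Qed.

Lemma lone_neq0 : lone != 0.
Proof.
apply/eqP => /(congr1 (fun u : laurent => u 0)).
by rewrite lcoef_mono eqxx lcoef0 => /eqP; rewrite oner_eq0.
Qed.

HB.instance Definition _ := GRing.Zmodule_isNzRing.Build laurent
  lmulA lmul1l lmul1r lmulDl lmulDr lone_neq0.

Lemma lmonoXC (a : A) :
  (lmono 1 1 : laurent) * lmono a 0 = lmono (sigma a) 0 * lmono 1 1.
Proof.
rewrite [LHS]lmonoM [RHS]lmonoM /= mul1r mulr1.
by apply: laurent_ext => i; rewrite !lcoef_mono.
Qed.

End Laurent.

Section LaurentDivision.
Variables (A : divRingType) (sigma : ringAut A).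
Local Notation D := (laurent sigma).
Implicit Types u v : D.

Lemma laurent_lowest u : u != 0 ->
  exists k : int, u k != 0 /\ forall i, i < k -> u i = 0.
Proof.
move=> u0; have [b ub] := laurent_bound u.
have [j uj] : exists j, u j != 0.
  apply: contrapT => H; case/eqP: u0; apply: laurent_ext => i.
  by apply/eqP; apply: contrapT => /negP ui; apply: H; exists i.
have ex : exists m : nat, u (b + m%:Z) != 0.
  have [jb|bj] := ltP j b; first by rewrite ub ?eqxx in uj.
  by exists (absz (j - b)); have -> : b + (absz (j - b))%:Z = j by lia.
case: (ex_minnP ex) => m um mmin; exists (b + m%:Z); split => // i im.
have [ib|bi] := ltP i b; first exact: ub.
apply/eqP; apply: contrapT => /negP ui.
have /mmin : u (b + (absz (i - b))%:Z) != 0.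
  by have -> : b + (absz (i - b))%:Z = i by lia.
by lia.
Qed.

Lemma course_of_values (T : Type) (F : nat -> (nat -> T) -> T) :
  (forall m p q, (forall j, (j < m)%N -> p j = q j) -> F m p = F m q) ->
  inhabited T -> exists p : nat -> T, forall m, p m = F m p.
Proof.
move=> Fext [t0].
have [S S0 SE] : exists2 S : nat -> seq T, S 0%N = [::] &
    forall n, S n.+1 = rcons (S n) (F n (nth t0 (S n))).
  by exists (fix S n := if n is n'.+1 then rcons (S n') (F n' (nth t0 (S n')))
                        else [::]).
have sS n : size (S n) = n by elim: n => [|n IH]; rewrite ?S0 // SE size_rcons IH.
have nS d m : nth t0 (S (m.+1 + d)%N) m = nth t0 (S m.+1) m.
  elim: d => [|d IH]; first by rewrite addn0.
  by rewrite addnS -IH SE nth_rcons sS ifT //; lia.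
exists (fun m => nth t0 (S m.+1) m) => m.
rewrite {1}SE nth_rcons sS ltnn eqxx; apply: Fext => j jm.
by have -> : m = (j.+1 + (m - j.+1))%N by lia.
Qed.

Lemma laurent_rinv u : u != 0 -> exists v, u * v = 1.
Proof.
move=> /laurent_lowest[k [uk ub]].
have ukU : u k \is a GRing.unit by exact: divring_unitP.
pose F (m : nat) (p : nat -> A) : A :=
  autX sigma (- k) ((u k)^-1 * ((m == 0%N)%:R -
    \sum_(j < m) u (k + m%:Z - j%:Z) * autX sigma (k + m%:Z - j%:Z) (p j))).
have [] := @course_of_values A F.
- move=> m p q pq; rewrite /F; congr (autX _ _ (_ * (_ - _))).
  by apply: eq_bigr => j _; rewrite pq.
- by constructor; exact: 0.
move=> p pF.
pose g (i : int) : A := if i < - k then 0 else p (absz (i + k)).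
have gb : g \in bounded_below A.
  by apply/bounded_belowP; exists (- k) => i; rewrite /g => ->.
pose v : D := Laurent sigma gb.
have vb i : i < - k -> v i = 0 by rewrite /= /g => ->.
exists v; apply: laurent_ext => n.
have -> : (1 : D) n = (n == 0)%:R by rewrite [LHS]lcoef_mono; case: eqP.
have [n0|n0] := ltP n 0.
  rewrite [LHS](lcoef_mulE (s := [::]) ub vb) ?big_nil //; last by move=> i; lia.
  by case: eqP => //; lia.
case: n n0 => // m _.
rewrite [LHS](lcoef_mulE (s := [seq k + m%:Z - j%:Z | j <- iota 0 m.+1]) ub vb).
- rewrite big_map -[iota 0 m.+1]/(index_iota 0 m.+1) big_mkord big_ord_recr /=.
  have -> : k + m%:Z - m%:Z = k by lia.
  have gE (j : nat) : (j <= m)%N -> g (m%:Z - (k + m%:Z - j%:Z)) = p j.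
    move=> jm; rewrite /g ifF; last by lia.
    congr (p _); lia.
  have -> : g (m%:Z - k) = p m.
    by rewrite -(gE m) //; congr (g _); lia.
  rewrite [p m]pF /F -autXD subrr /= mulrA divrr // mul1r.
  rewrite addrC; under [X in _ + X]eq_bigr => j _ do rewrite gE ?(ltnW (ltn_ord j)) //.
  by rewrite subrK.
- by rewrite map_inj_uniq ?iota_uniq // => i j; lia.
- move=> i iP; apply/mapP; exists (absz (k + m%:Z - i)%R); last by lia.
  by rewrite mem_iota; lia.
Qed.

Lemma laurent_inv u : u != 0 -> exists v, v * u = 1 /\ u * v = 1.
Proof.
move=> u0; have [v uv] := laurent_rinv u0; exists v; split=> //.
have v0 : v != 0.
  by apply: contraTneq isT => v0; move/eqP: uv; rewrite v0 mulr0 eq_sym oner_eq0.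
have [w vw] := laurent_rinv v0.
by rewrite -[u]mulr1 -vw (mulrA u) uv mul1r.
Qed.

Definition linv u : D :=
  if pselect (u != 0) is left u0 then projT1 (cid (laurent_inv u0)) else u.

Lemma lmulVr : {in [pred u : D | u != 0], left_inverse 1 linv *%R}.
Proof.
move=> u; rewrite inE /linv => u0; case: pselect => // u0'.
by case: cid => v /= [].
Qed.

Lemma lmulrV : {in [pred u : D | u != 0], right_inverse 1 linv *%R}.
Proof.
move=> u; rewrite inE /linv => u0; case: pselect => // u0'.
by case: cid => v /= [].
Qed.

Lemma lunitP u v : v * u = 1 /\ u * v = 1 -> u != 0.
Proof.
move=> [vu _]; apply: contraTneq isT => u0.
by move/eqP: vu; rewrite u0 mulr0 eq_sym oner_eq0.
Qed.

Lemma linv_out : {in [predC [pred u : D | u != 0]], linv =1 id}.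
Proof. by move=> u; rewrite !inE /linv => u0; case: pselect => // u1; rewrite u1 in u0. Qed.

HB.instance Definition _ := GRing.NzRing_hasMulInverse.Build D
  lmulVr lmulrV lunitP linv_out.

Lemma laurent_divring : GRing.field_axiom D.
Proof. by []. Qed.

HB.instance Definition _ := isDivisionRing.Build D laurent_divring.

End LaurentDivision.

(* Main.v *)
(** For [g != 0] in [D], the lowest term [a x^k] is multiplicative in [g], and
    [D^*] modulo the 1-units [1 + a_1 x + ...] is the group of monomials
    [a x^k]. Let [M] be an abelian maximal subgroup and [H] the subgroup of all
    elements having the same lowest term as some element of [M]. If [H = D^*],
    then the group of monomials is abelian; otherwise [H] is contained in [M],
    so that the 1-units [1 + a x] and [1 + b x] commute. In either case [A] is
    commutative and [sigma] is the identity. *)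
Require Import Defs.
From mathcomp Require Import all_boot all_order all_algebra.
From mathcomp Require Import boolp classical_sets.
From mathcomp Require Import zify.

Set Implicit Arguments.
Unset Strict Implicit.
Unset Printing Implicit Defensive.

Import Order.TTheory GRing.Theory Num.Theory.

Local Open Scope classical_set_scope.

Section LowestTerm.
Local Open Scope ring_scope.
Variables (A : divRingType) (sigma : ringAut A).
Local Notation D := (laurent sigma).
Implicit Types (u v : D) (k l : int) (a b : A).

Definition lowest_term u k a :=
  [/\ u k = a, a != 0 & forall i, i < k -> u i = 0].

Lemma lowest_term_ex u : u != 0 -> exists k a, lowest_term u k a.
Proof. by move=> /laurent_lowest[k [uk ub]]; exists k, (u k). Qed.

Lemma lowest_term_uniq u k l a b :
  lowest_term u k a -> lowest_term u l b -> k = l /\ a = b.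
Proof.
move=> [ua a0 uk] [ub b0 ul].
have kl : k = l.
  have [kl|lk|//] := ltgtP k l.
  - by move: a0; rewrite -ua ul ?eqxx.
  - by move: b0; rewrite -ub uk ?eqxx.
by split=> //; rewrite -ua kl.
Qed.

Lemma lowest_term_mono a k : a != 0 -> lowest_term (lmono sigma a k) k a.
Proof.
by move=> a0; split=> // [|i ik]; rewrite lcoef_mono ?eqxx // ifF //; lia.
Qed.

(** Below degree [k + l] no index contributes to the convolution, and at [k + l] only the index [k]
    does. The coefficient is nonzero because [autX sigma k] is injective and [A] is a division
    ring. *)
Lemma lowest_termM u v k l a b : lowest_term u k a -> lowest_term v l b ->
  lowest_term (u * v) (k + l) (a * autX sigma k b).
Proof.
move=> [ua a0 uk] [vb b0 vl]; split.
- rewrite [LHS](lcoef_mulE (s := [:: k]) uk vl) //.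
    by rewrite big_seq1 ua addrAC subrr add0r vb.
  by move=> i; rewrite inE; lia.
- apply: unit_neq0; rewrite unitrMl ?divring_unitP //.
  apply: contra_neq b0 => /(congr1 (autX sigma (- k))).
  by rewrite -autXD addNr rmorph0.
- move=> n nkl; rewrite [LHS](lcoef_mulE (s := [::]) uk vl) ?big_nil //.
  by move=> i; lia.
Qed.

Lemma lowest_termV u k a : lowest_term u k a ->
  lowest_term u^-1 (- k) (autX sigma (- k) a^-1).
Proof.
move=> ua; have [uk a0 _] := ua.
have u0 : u != 0 by apply: contra_eq_neq uk => ->; rewrite lcoef0 eq_sym.
have uU : u \is a GRing.unit by exact: divring_unitP.
have aU : a \is a GRing.unit by exact: divring_unitP.
have [|l [b vb]] := @lowest_term_ex u^-1; first by apply: unit_neq0; rewrite unitrV.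
have := lowest_termM ua vb; rewrite divrr //.
(* Since [1] is [lmono sigma 1 0], uniqueness gives [0 = k + l] and [1 = a * autX sigma k b]. *)
have /lowest_term_uniq /[apply] -[kl ab] :=
  @lowest_term_mono 1 0 (oner_neq0 A).
have lk : l = - k by lia.
have -> : autX sigma (- k) a^-1 = b; last by rewrite -lk.
by rewrite -[a^-1]mulr1 ab mulKr // -autXD addNr.
Qed.

Lemma lowest_term_1unit a : lowest_term (1 + lmono sigma a 1) 0 1.
Proof.
split; [|exact: oner_neq0|move=> i i0];
  rewrite lcoefD [X in X + _]lcoef_mono lcoef_mono ?addr0 //.
by rewrite !ifF ?addr0 //; lia.
Qed.

End LowestTerm.

Section LowestTermSaturation.
Variables (A : divRingType) (sigma : ringAut A).
Local Notation G := (mulgroup (laurent sigma)).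
Implicit Types (g h m : G) (M : set G).

Definition same_lowest g h :=
  exists k a, lowest_term (val g) k a /\ lowest_term (val h) k a.

(** Equivalently, the product of [M] with the 1-units. *)
Definition saturation M : set G := [set g | exists2 m, M m & same_lowest g m].

Lemma same_lowest_refl g : same_lowest g g.
Proof. by have [k [a ga]] := lowest_term_ex (valP g); exists k, a. Qed.

Lemma saturation_sub M : M `<=` saturation M.
Proof. by move=> g Mg; exists g => //; exact: same_lowest_refl. Qed.

(** The lowest term of a quotient depends only on the lowest terms of its two factors. *)
Lemma saturation_subgroup M : subgroup M -> subgroup (saturation M).
Proof.
move=> [/set_mem M1 MV]; split; first exact/mem_set/saturation_sub.
move=> g h /set_mem[m Mm [k [a [ga ma]]]] /set_mem[n Mn [l [b [hb nb]]]].
apply/mem_set; exists (m / n)%g; first by apply/set_mem/MV; exact: mem_set.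
exists (k - l)%R, (a * autX sigma k (autX sigma (- l) b^-1))%R.
by split; apply: lowest_termM => //; exact: lowest_termV.
Qed.

(** By maximality [saturation M] is the whole group or [M]. In the first case lowest terms can be
    computed on commuting representatives in [M]; in the second [M] contains every 1-unit, as these
    share the lowest term of [1]. *)
Lemma abelian_maximal_dichotomy M : maximal_subgroup M -> abelian_set M ->
  (forall g h, same_lowest (g * h) (h * g))%g \/
  (forall g h, lowest_term (val g) 0 1%R -> lowest_term (val h) 0 1%R ->
    commute g h).
Proof.
move=> [sM _ maxM] cM; have sS := saturation_subgroup sM.
have [ST|SnT] := pselect (saturation M = [set: G]); [left|right].
  move=> g h.
  have [m Mm [k [a [ga ma]]]] : saturation M g by rewrite ST.
  have [n Mn [l [b [hb nb]]]] : saturation M h by rewrite ST.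
  have mn : (val m * val n = val n * val m)%R by rewrite -[LHS]/(val (m * n)%g) cM.
  exists (k + l)%R, (a * autX sigma k b)%R; split; first exact: lowest_termM.
  (* As [m] and [n] commute, the two formulas for the lowest term of their product agree. *)
  have := lowest_termM ma nb; rewrite mn => mn1.
  have [-> ->] := lowest_term_uniq mn1 (lowest_termM nb ma).
  exact: lowest_termM.
have SM : saturation M `<=` M.
  apply: contrapT => nSM; apply: (maxM _ sS).
    by split=> // TS; apply: SnT; rewrite eqEsubset; split.
  by split=> //; exact: saturation_sub.
have M1 : M 1%g by apply/set_mem; case: sM.
have unitM g : lowest_term (val g) 0 1%R -> M g.
  move=> g1; apply: SM; exists 1%g => //; exists 0%R, 1%R; split=> //.
  exact/lowest_term_mono/oner_neq0.
by move=> g h /unitM Mg /unitM Mh; exact: cM.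
Qed.

End LowestTermSaturation.

Theorem proposition4p3 (A : divRingType) (sigma : ringAut A) :
  ~ abelian_set [set: mulgroup A] \/ aut_fun sigma <> idfun :> (A -> A) ->
  ~ exists M : set (mulgroup (laurent sigma)),
      maximal_subgroup M /\ abelian_set M.
Proof.
move=> nc [M [maxM cM]].
have D0 (u : laurent sigma) k a : lowest_term u k a -> u != 0%R.
  by move=> [<- uk _]; apply: contra_neq uk => ->; rewrite lcoef0.
suff [sid ab] : (forall a, sigma a = a) /\ (forall a b : A, a * b = b * a)%R.
  case: nc => [[]|[]]; last exact: funext.
  by move=> a b _ _; apply: val_inj; exact: ab.
have [low|com] := abelian_maximal_dichotomy maxM cM.
  (* Multiply [a x^k] and [b x^l] in both orders and compare coefficients. *)
  have lowE (a b : A) k l : a != 0%R -> b != 0%R ->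
      (a * autX sigma k b = b * autX sigma l a)%R.
    move=> a0 b0.
    have am := lowest_term_mono sigma k a0; have bm := lowest_term_mono sigma l b0.
    have [r [c [abc bac]]] := low (MulGroup (D0 _ _ _ am)) (MulGroup (D0 _ _ _ bm)).
    have [_ ->] := lowest_term_uniq (lowest_termM am bm) abc.
    by have [_ <-] := lowest_term_uniq (lowest_termM bm am) bac.
  split=> [a|a b].
    have [->|a0] := eqVneq a 0%R; first exact: rmorph0.
    (* The monomials are [x] and the constant [a]. *)
    by have := lowE 1%R a 1%R 0%R (oner_neq0 A) a0; rewrite mul1r mulr1.
  have [->|a0] := eqVneq a 0%R; first by rewrite mul0r mulr0.
  have [->|b0] := eqVneq b 0%R; first by rewrite mul0r mulr0.
  exact: (lowE a b 0%R 0%R).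
(* In [(1 + a x)(1 + b x)] the terms of degree 0 and 1 are symmetric in [a] and [b], so commutation
   reduces to the coefficient of [x^2]. *)
have comE (a b : A) : (a * sigma b = b * sigma a)%R.
  have a1 := lowest_term_1unit sigma a; have b1 := lowest_term_1unit sigma b.
  have /(congr1 val) /= := com (MulGroup (D0 _ _ _ a1)) (MulGroup (D0 _ _ _ b1)) a1 b1.
  rewrite !mulrDl !mul1r !mulrDr !mulr1 -!addrA => /addrI.
  rewrite addrCA => /addrI /addrI.
  by move=> /(congr1 (fun u : laurent sigma => u (1 + 1)%R)); rewrite !lcoef_monol.
have sid a : sigma a = a by have := comE 1%R a; rewrite rmorph1 mul1r mulr1.
by split=> // a b; have := comE a b; rewrite !sid.
Qed.
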